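(* Let $K$ be a countably-test-complete bdKAT, $A$ a Kleene abstract domain of $K$ with maps $\alpha,\gamma$, and $T_{\Sigma,B}$ a KAT language interpreted on $K$. For all $p,q\in\mathrm{Test}(K)$ and $t\in T_{\Sigma,B}$, if the triple $[p]\,t\,[q]$ is derivable in the proof system $\mathrm{LCK}_A$, then (i) $q\le\mathcal{S}[t]\,p$, and (ii) $\mathcal{S}^\sharp[t]\,\alpha(p)=\alpha(q)=\alpha(\mathcal{S}[t]\,p)$.
   Context: An idempotent semiring $(K,+,\cdot,0,1)$: $(K,+,0)$ commutative monoid with $a+a=a$, $(K,\cdot,1)$ monoid, $\cdot$ distributes over $+$ on both sides, $0a=a0=0$; ordered by $a\le b$ iff $a+b=b$. A KAT is an idempotent semiring $K$ with a subset $\mathrm{Test}(K)$ that is a Boolean algebra with join $+$, meet $\cdot$, complement $\neg$, bottom $0$, top $1$, and ${}^*$ with $1+aa^*\le a^*$, $1+a^*a\le a^*$, $b+ac\le c\Rightarrow a^*b\le c$, $b+ca\le c\Rightarrow ba^*\le c$. CTC: every countable subset of $\mathrm{Test}(K)$ has a least upper bound. bdKAT: a KAT with $\langle\cdot]\cdot:K\to(\mathrm{Test}(K)\to\mathrm{Test}(K))$ such that $\langle a]p\le q\iff pa\le aq$ and $\langle ab]p=\langle b](\langle a]p)$. KAT language: disjoint sets $\Sigma$, $B$ (with $\mathtt0,\mathtt1\in B$), $\mathrm{Atom}=\Sigma\cup B$, terms $t::=\mathtt a\in\mathrm{Atom}\mid\mathtt0\mid\mathtt1\mid t_1+t_2\mid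 t_1\cdot t_2\mid t^*$; an evaluation $u:\mathrm{Atom}\to K$ with $u(B)\subseteq\mathrm{Test}(K)$ extends homomorphically to $\llbracket\cdot\rrbracket_u:T_{\Sigma,B}\to K$ (sum, product, star). Concrete semantics $\mathcal{S}[t]\,p:=\langle\llbracket t\rrbracket_u]p$. A Kleene abstract domain: poset $(A,\le_A)$ with a Galois insertion $\alpha:\mathrm{Test}(K)\to A$, $\gamma:A\to\mathrm{Test}(K)$ ($\alpha(p)\le_A x\iff p\le\gamma(x)$, $\alpha\circ\gamma=\mathrm{id}$), every countable subset of $A$ having a lub. Abstract semantics: $\mathcal{S}^\sharp[\mathtt a]x=\alpha(\mathcal{S}[\mathtt a]\gamma(x))$, $\mathcal{S}^\sharp[t_1+t_2]x=\mathcal{S}^\sharp[t_1]x\vee_A\mathcal{S}^\sharp[t_2]x$, $\mathcal{S}^\sharp[t_1\cdot t_2]x=\mathcal{S}^\sharp[t_2](\mathcal{S}^\sharp[t_1]x)$, $\mathcal{S}^\sharp[t^*]x=\bigvee_n(\mathcal{S}^\sharp[t])^nx$. Write $A(p):=\gamma(\alpha(p))$. For $f:\mathrm{Test}(K)\to\mathrm{Test}(K)$, $A$ is locally complete for $f$ on $p$, written $\mathbb C^A_p(f)$, if $A(f(p))=A(f(A(p)))$. Proof system $\mathrm{LCK}_A$ (triples $[p]\,t\,[q]$ with $p,q\in\mathrm{Test}(K)$): (transfer) if $\mathtt a\in\Sigma\cup B$ and $\mathbb C^A_p(\mathcal S[\mathtt a])$ then $[p]\,\mathtt a\,[\mathcal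 S[\mathtt a]p]$; (relax) from $p'\le p\le A(p')$, $[p']\,t\,[q']$, $q\le q'\le A(q')$ infer $[p]\,t\,[q]$; (seq) from $[p]\,t_1\,[r]$, $[r]\,t_2\,[q]$ infer $[p]\,t_1\cdot t_2\,[q]$; (join) from $[p]\,t_1\,[q_1]$, $[p]\,t_2\,[q_2]$ infer $[p]\,t_1+t_2\,[q_1+q_2]$; (rec) from $[p]\,t\,[r]$, $[p+r]\,t^*\,[q]$ infer $[p]\,t^*\,[q]$; (iterate) from $[p]\,t\,[q]$ and $q\le A(p)$ infer $[p]\,t^*\,[p+q]$.
   Formalization: In rule (relax) the side condition q ≤ q' ≤ A(q') is corrected to q ≤ q' ≤ A(q); with the printed condition the rule would derive [p] t [0] from any derivable triple, and claim (ii) would fail. *)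

(* Defs.v *)
From mathcomp Require Import all_boot all_order all_algebra.
From mathcomp Require Import boolp classical_sets cardinality.

Set Implicit Arguments.
Unset Strict Implicit.
Unset Printing Implicit Defensive.

Import Order.TTheory GRing.Theory.

Local Open Scope classical_set_scope.
Local Open Scope ring_scope.

Definition sr_le (K : pzSemiRingType) (a b : K) : Prop := a + b = b.

Notation "a <=+ b" := (sr_le a b) (at level 70, no associativity) : ring_scope.

(* The subset Test(K) is presented by a Boolean algebra [Test] (in MathComp's
   order library, a complemented distributive lattice with bottom and top)
   together with an injection [tval] of [Test] into K that sends join, meet,
   bottom and top to +, *, 0 and 1. Injectivity and [tvalU] make the order of
   [Test] the restriction of [<=+]. *)
Record KAT := MkKAT {
  kat_sort :> pzSemiRingType;
  kat_addxx : forall a : kat_sort, a + a = a;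
  test_disp : Order.disp_t;
  Test : ctbDistrLatticeType test_disp;
  tval : Test -> kat_sort;
  tval_inj : injective tval;
  tvalU : forall p q : Test, tval (Order.join p q) = tval p + tval q;
  tvalI : forall p q : Test, tval (Order.meet p q) = tval p * tval q;
  tval0 : tval \bot%O = 0;
  tval1 : tval \top%O = 1;
  star : kat_sort -> kat_sort;
  star_unfoldl : forall a : kat_sort, 1 + a * star a <=+ star a;
  star_unfoldr : forall a : kat_sort, 1 + star a * a <=+ star a;
  star_indl : forall a b c : kat_sort, b + a * c <=+ c -> star a * b <=+ c;
  star_indr : forall a b c : kat_sort, b + c * a <=+ c -> b * star a <=+ c
}.

Definition has_countable_lubs (d : Order.disp_t) (T : porderType d) : Prop :=
  forall X : set T, countable X -> exists m : T, isLub X m.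

Definition countably_test_complete (K : KAT) : Prop :=
  has_countable_lubs (Test K).

Record bdKAT := MkBdKAT {
  bdKAT_KAT :> KAT;
  bdia : bdKAT_KAT -> Test bdKAT_KAT -> Test bdKAT_KAT;
  bdiaP : forall (a : bdKAT_KAT) (p q : Test bdKAT_KAT),
    (bdia a p <= q)%O <-> tval p * a <=+ a * tval q;
  bdiaM : forall (a b : bdKAT_KAT) (p : Test bdKAT_KAT),
    bdia (a * b) p = bdia b (bdia a p)
}.

(* The constant symbols 0 and 1 belong to the set B of test symbols. *)
Record katLang := MkKatLang {
  actSym : Type;
  testSym : Type;
  sym0 : testSym;
  sym1 : testSym
}.

Definition atom (L : katLang) : Type := (actSym L + testSym L)%type.

(* The terms 0 and 1 are [TAtom (inr (sym0 L))] and [TAtom (inr (sym1 L))]. *)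
Inductive term (L : katLang) : Type :=
  | TAtom of atom L
  | TAdd of term L & term L
  | TMul of term L & term L
  | TStar of term L.

Record evaluation (L : katLang) (K : KAT) := MkEvaluation {
  ev :> atom L -> K;
  ev_test : forall b : testSym L, exists p : Test K, ev (inr b) = tval p;
  ev_sym0 : ev (inr (sym0 L)) = 0;
  ev_sym1 : ev (inr (sym1 L)) = 1
}.

Fixpoint denot (L : katLang) (K : KAT) (u : evaluation L K) (t : term L) : K :=
  match t with
  | TAtom a => u a
  | TAdd t1 t2 => denot u t1 + denot u t2
  | TMul t1 t2 => denot u t1 * denot u t2
  | TStar t1 => star (denot u t1)
  end.

Definition csem (L : katLang) (K : bdKAT) (u : evaluation L K) (t : term L)
  (p : Test K) : Test K := bdia (denot u t) p.

Record kleeneDomain (K : KAT) := MkKleeneDomain {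
  dom_disp : Order.disp_t;
  dom_sort :> porderType dom_disp;
  alpha : Test K -> dom_sort;
  gamma : dom_sort -> Test K;
  dom_galois : forall (p : Test K) (x : dom_sort),
    (alpha p <= x)%O <-> (p <= gamma x)%O;
  dom_insertion : forall x : dom_sort, alpha (gamma x) = x;
  dom_lubs : has_countable_lubs dom_sort
}.

Definition clos (K : KAT) (A : kleeneDomain K) (p : Test K) : Test K :=
  gamma (alpha A p).

(* The default value [x] of [supremum] is never used: by [dom_lubs] the
   nonempty countable sets below have a (unique) least upper bound. *)
Fixpoint asem (L : katLang) (K : bdKAT) (u : evaluation L K)
    (A : kleeneDomain K) (t : term L) (x : A) : A :=
  match t with
  | TAtom a => alpha A (csem u (TAtom a) (gamma x))
  | TAdd t1 t2 => supremum x [set asem u t1 x; asem u t2 x]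
  | TMul t1 t2 => asem u t2 (asem u t1 x)
  | TStar t1 => supremum x (range (fun n : nat => iter n (asem u t1) x))
  end.

Definition locally_complete (K : KAT) (A : kleeneDomain K)
    (f : Test K -> Test K) (p : Test K) : Prop :=
  clos A (f p) = clos A (f (clos A p)).

(* In [LCK_relax] the postcondition may shrink from q' to q only as long as
   q' <= A(q). Reading this bound as q' <= A(q') would make it vacuous, and the
   system would derive [p] t [0] for every derivable [p] t [q']. *)
Inductive LCK (L : katLang) (K : bdKAT) (u : evaluation L K)
    (A : kleeneDomain K) : Test K -> term L -> Test K -> Prop :=
  | LCK_transfer (p : Test K) (a : atom L) :
      locally_complete A (csem u (TAtom a)) p ->
      LCK u A p (TAtom a) (csem u (TAtom a) p)
  | LCK_relax (p p' q q' : Test K) (t : term L) :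
      (p' <= p)%O -> (p <= clos A p')%O ->
      LCK u A p' t q' ->
      (q <= q')%O -> (q' <= clos A q)%O ->
      LCK u A p t q
  | LCK_seq (p r q : Test K) (t1 t2 : term L) :
      LCK u A p t1 r -> LCK u A r t2 q -> LCK u A p (TMul t1 t2) q
  | LCK_join (p q1 q2 : Test K) (t1 t2 : term L) :
      LCK u A p t1 q1 -> LCK u A p t2 q2 ->
      LCK u A p (TAdd t1 t2) (Order.join q1 q2)
  | LCK_rec (p r q : Test K) (t : term L) :
      LCK u A p t r -> LCK u A (Order.join p r) (TStar t) q ->
      LCK u A p (TStar t) q
  | LCK_iterate (p q : Test K) (t : term L) :
      LCK u A p t q -> (q <= clos A p)%O ->
      LCK u A p (TStar t) (Order.join p q).

(* Main.v *)
From mathcomp Require Import all_boot all_order.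
From mathcomp Require Import ssralg classical_sets cardinality.
Require Import Defs.

(** The induction on derivations of [p] t [q] carries four facts: q <= S[t] p,
    S#[t] (alpha p) <= alpha q, S[t] (A p) <= A q, and the existence of a
    finitely additive F with q <= F p and alpha \o F \o gamma <= S#[t]
    pointwise. Such an F arises by unrolling each star of t only as often as
    the derivation does. It replaces the global soundness
    alpha (S[t] (gamma x)) <= S#[t] x, which would require
    <a*]p = \/_n <a]^n p, whereas the axioms of the backward diamond only give
    preservation of finite joins. *)

Set Implicit Arguments.
Unset Strict Implicit.
Unset Printing Implicit Defensive.

Import Order.Theory GRing.Theory.

Local Open Scope classical_set_scope.
Local Open Scope ring_scope.

(** * The natural order, tests and star *)

Section SemiringOrder.
Variable K : KAT.
Implicit Types (a b c : K) (p q : Test K).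

Lemma sr_lexx a : a <=+ a.
Proof. exact: kat_addxx. Qed.

Lemma sr_le_trans b a c : a <=+ b -> b <=+ c -> a <=+ c.
Proof. by rewrite /sr_le => ab <-; rewrite addrA ab. Qed.

Lemma sr_leDl a b : a <=+ a + b.
Proof. by rewrite /sr_le addrA kat_addxx. Qed.

Lemma sr_leDr a b : b <=+ a + b.
Proof. by rewrite addrC; exact: sr_leDl. Qed.

Lemma sr_leD_lub a b c : a <=+ c -> b <=+ c -> a + b <=+ c.
Proof. by rewrite /sr_le => ac bc; rewrite -addrA bc. Qed.

Lemma sr_leMl c a b : a <=+ b -> c * a <=+ c * b.
Proof. by rewrite /sr_le => ab; rewrite -mulrDr ab. Qed.

Lemma sr_leMr c a b : a <=+ b -> a * c <=+ b * c.
Proof. by rewrite /sr_le => ab; rewrite -mulrDl ab. Qed.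

Lemma sr_le0 a : a <=+ 0 -> a = 0.
Proof. by rewrite /sr_le addr0. Qed.

Lemma tval_le p q : (p <= q)%O -> tval p <=+ tval q.
Proof. by move=> /join_r pq; rewrite /sr_le -tvalU pq. Qed.

Lemma tval_le1 p : tval p <=+ 1.
Proof. by rewrite -tval1; apply: tval_le; exact: lex1. Qed.

Lemma tval_mulC p : tval p * tval (~` p)%O = 0.
Proof. by rewrite -tvalI meetxC tval0. Qed.

Lemma tval_addC p : tval p + tval (~` p)%O = 1.
Proof. by rewrite -tvalU joinxC tval1. Qed.

Lemma star_ge1 a : 1 <=+ star a.
Proof. exact: sr_le_trans (sr_leDl _ _) (star_unfoldl a). Qed.

Lemma star_mulr a : star a * a <=+ star a.
Proof. exact: sr_le_trans (sr_leDr _ _) (star_unfoldr a). Qed.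

Lemma star_mull a : a * star a <=+ star a.
Proof. exact: sr_le_trans (sr_leDr _ _) (star_unfoldl a). Qed.

End SemiringOrder.

(** * Monotonicity, subadditivity and star laws of the backward diamond *)

Section BackwardDiamond.
Variable K : bdKAT.
Implicit Types (a b : K) (p q : Test K).

Lemma mul_bdia_le a p : tval p * a <=+ a * tval (bdia a p).
Proof. exact/bdiaP. Qed.

Lemma le_bdia a p q : (p <= q)%O -> (bdia a p <= bdia a q)%O.
Proof.
move=> pq; apply/bdiaP; apply: sr_le_trans (mul_bdia_le a q).
exact/sr_leMr/tval_le.
Qed.

Lemma bdiaU_le a p q :
  (bdia a (p `|` q) <= bdia a p `|` bdia a q)%O.
Proof.
apply/bdiaP; rewrite !tvalU mulrDl mulrDr.
apply: sr_leD_lub.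
  exact: sr_le_trans (mul_bdia_le a p) (sr_leDl _ _).
exact: sr_le_trans (mul_bdia_le a q) (sr_leDr _ _).
Qed.

(* From p b <= b q, with q := <b]p, one gets p a ~q <= p b ~q <= b q ~q = 0,
   hence p a = p a q <= a q. *)
Lemma bdia_lel a b p : a <=+ b -> (bdia a p <= bdia b p)%O.
Proof.
move=> ab; set q := bdia b p; apply/bdiaP.
have pa0 : tval p * a * tval (~` q)%O = 0.
  apply: sr_le0; apply: (@sr_le_trans _ (tval p * b * tval (~` q)%O)).
    exact/sr_leMr/sr_leMl.
  apply: sr_le_trans (sr_leMr _ (mul_bdia_le b p)) _.
  by rewrite -mulrA tval_mulC mulr0; exact: sr_lexx.
rewrite -[X in X <=+ _]mulr1 -(tval_addC q) mulrDr pa0 addr0 -mulrA.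
by rewrite -[X in _ <=+ X]mul1r; apply: sr_leMr; exact: tval_le1.
Qed.

Lemma bdiaD_le a b p : (bdia (a + b) p <= bdia a p `|` bdia b p)%O.
Proof.
apply/bdiaP; rewrite tvalU mulrDr mulrDl mulrDr mulrDr.
apply: sr_leD_lub.
  apply: sr_le_trans (mul_bdia_le a p) _.
  exact: sr_le_trans (sr_leDl _ _) (sr_leDl _ _).
apply: sr_le_trans (mul_bdia_le b p) _.
exact: sr_le_trans (sr_leDr _ _) (sr_leDr _ _).
Qed.

Lemma bdia1_ge p : (p <= bdia 1 p)%O.
Proof.
have := mul_bdia_le 1 p; rewrite mulr1 mul1r /sr_le -tvalU => /tval_inj pq.
by rewrite leEjoin pq.
Qed.

Lemma bdia_star_ge p a : (p <= bdia (star a) p)%O.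
Proof.
exact: le_trans (bdia1_ge p) (bdia_lel _ (star_ge1 a)).
Qed.

Lemma bdia_star_unfold a p :
  (bdia (star a) (bdia a p) <= bdia (star a) p)%O.
Proof. by rewrite -bdiaM; apply: bdia_lel; exact: star_mull. Qed.

(** With [p] also written for its value in [K], right star induction is applied to the bound
    [star a * p]: from [p * a <=+ a * p] follows [star a * p * a <=+ star a * a * p <=+ star a *
    p]. *)
Lemma bdia_star_inv a p : (bdia a p <= p)%O -> (bdia (star a) p <= p)%O.
Proof.
move=> /bdiaP pa; apply/bdiaP; apply: star_indr; apply: sr_leD_lub.
  by rewrite -[X in X <=+ _]mul1r; apply: sr_leMr; exact: star_ge1.
rewrite -mulrA; apply: sr_le_trans (sr_leMl _ pa) _.
by rewrite mulrA; apply: sr_leMr; exact: star_mulr.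
Qed.

End BackwardDiamond.

(** * [supremum] as a genuine least upper bound *)

Section Supremum.
Variables (d : Order.disp_t) (T : porderType d).
Hypothesis lubT : has_countable_lubs T.

(** [supremum] returns its default on the empty set and when no least upper bound exists; [X0]
    excludes the first case, the bound [m] the second. *)
Lemma supremum_isLub (x : T) (X : set T) :
  X !=set0 -> countable X -> isLub X (supremum x X).
Proof.
move=> X0 cX; have [m [mub mlub]] := lubT cX.
rewrite /supremum; case: ifPn => [/eqP X_0|_].
  by move: X0; rewrite X_0 => -[].
by case: xgetP => [y _ []//|/(_ m)] []; split.
Qed.

Lemma supremum2_isLub (x y z : T) : isLub [set y; z] (supremum x [set y; z]).
Proof.
apply: supremum_isLub; first by exists y; left.
exact/finite_set_countable/finite_set2.
Qed.

Lemma supremum_range_isLub (x : T) (h : nat -> T) :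
  isLub (range h) (supremum x (range h)).
Proof.
apply: supremum_isLub; first by exists (h 0%N), 0%N.
exact: card_image_le.
Qed.

End Supremum.

(** * Consequences of the Galois insertion *)

Section KleeneDomain.
Variables (K : KAT) (A : kleeneDomain K).
Implicit Types p q : Test K.

Lemma clos_ge p : (p <= clos A p)%O.
Proof. exact/dom_galois. Qed.

Lemma le_alpha p q : (p <= q)%O -> (alpha A p <= alpha A q)%O.
Proof. by move=> pq; apply/dom_galois; exact: le_trans (clos_ge q). Qed.

Lemma le_gamma (x y : A) : (x <= y)%O -> (gamma x <= gamma y)%O.
Proof. by move=> xy; apply/dom_galois; rewrite dom_insertion. Qed.

Lemma le_clos p q : (p <= q)%O -> (clos A p <= clos A q)%O.
Proof. by move=> pq; apply/le_gamma/le_alpha. Qed.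

Lemma alpha_le_clos p q : (alpha A p <= alpha A q)%O <-> (p <= clos A q)%O.
Proof. exact: dom_galois. Qed.

Lemma alphaU_le p q (x : A) :
  (alpha A p <= x)%O -> (alpha A q <= x)%O -> (alpha A (p `|` q) <= x)%O.
Proof.
by move=> /dom_galois px /dom_galois qx; apply/dom_galois; rewrite leUx px.
Qed.

Lemma alpha_between p q :
  (p <= q)%O -> (q <= clos A p)%O -> alpha A p = alpha A q.
Proof.
by move=> pq /alpha_le_clos qp; apply/le_anti; rewrite le_alpha.
Qed.

End KleeneDomain.

(** * Order properties of the abstract semantics *)

Section AbstractSemantics.
Variables (K : bdKAT) (A : kleeneDomain K) (L : katLang) (u : evaluation L K).
Implicit Types (x y z : A) (p q : Test K) (t : term L).

Lemma asem_addl t1 t2 x : (asem u t1 x <= asem u (TAdd t1 t2) x)%O.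
Proof.
by have [ub _] := supremum2_isLub (@dom_lubs _ A) x (asem u t1 x) (asem u t2 x);
  apply: ub; left.
Qed.

Lemma asem_addr t1 t2 x : (asem u t2 x <= asem u (TAdd t1 t2) x)%O.
Proof.
by have [ub _] := supremum2_isLub (@dom_lubs _ A) x (asem u t1 x) (asem u t2 x);
  apply: ub; right.
Qed.

Lemma asem_add_le t1 t2 x z :
  (asem u t1 x <= z)%O -> (asem u t2 x <= z)%O ->
  (asem u (TAdd t1 t2) x <= z)%O.
Proof.
move=> h1 h2.
have [_ lub] := supremum2_isLub (@dom_lubs _ A) x (asem u t1 x) (asem u t2 x).
by apply: lub => y [] ->.
Qed.

Lemma asem_star_ge t x n : (iter n (asem u t) x <= asem u (TStar t) x)%O.
Proof.
have [ub _] := supremum_range_isLub (@dom_lubs _ A) x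
  (fun n => iter n (asem u t) x).
by apply: ub; exists n.
Qed.

Lemma asem_star_le t x z :
  (forall n, (iter n (asem u t) x <= z)%O) -> (asem u (TStar t) x <= z)%O.
Proof.
move=> h; have [_ lub] := supremum_range_isLub (@dom_lubs _ A) x
  (fun n => iter n (asem u t) x).
by apply: lub => y [n _ <-].
Qed.

Lemma le_asem t x y : (x <= y)%O -> (asem u t x <= asem u t y)%O.
Proof.
elim: t x y => [a|t1 IH1 t2 IH2|t1 IH1 t2 IH2|t IH] x y xy.
- exact/le_alpha/le_bdia/le_gamma.
- apply: asem_add_le.
    exact: le_trans (IH1 _ _ xy) (asem_addl _ _ _).
  exact: le_trans (IH2 _ _ xy) (asem_addr _ _ _).
- exact/IH2/IH1.
- apply: asem_star_le => n; apply: le_trans (asem_star_ge t y n).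
  by elim: n => //= n IHn; exact: IH.
Qed.

(** The iterates from [asem u t x] are those from [x], shifted by one. *)
Lemma asem_star_unfold t x :
  (asem u (TStar t) (asem u t x) <= asem u (TStar t) x)%O.
Proof.
by apply: asem_star_le => n; rewrite -iterSr; exact: asem_star_ge.
Qed.

Lemma asem_star_inv t x : (asem u t x <= x)%O -> (asem u (TStar t) x <= x)%O.
Proof.
move=> tx; apply: asem_star_le; elim=> //= n IHn.
exact: le_trans (le_asem t IHn) tx.
Qed.

(** Additivity yields monotonicity and splits the precondition p + r of rule rec. The second clause
    bounds the best correct approximation of [F] by the abstract semantics. *)
Definition additive_approx (F : Test K -> Test K) t : Prop :=
  (forall p q, F (p `|` q)%O = (F p `|` F q)%O) /\
  (forall x, (alpha A (F (gamma x)) <= asem u t x)%O).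

Lemma additive_approx_le F t p q :
  additive_approx F t -> (p <= q)%O -> (F p <= F q)%O.
Proof. by move=> [FU _] /join_r pq; rewrite -pq FU leUl. Qed.

Lemma additive_approx_alpha F t p :
  additive_approx F t -> (alpha A (F p) <= asem u t (alpha A p))%O.
Proof.
move=> Fapp; have [_ Fle] := Fapp.
by apply: le_trans (Fle _); apply/le_alpha/(additive_approx_le Fapp)/clos_ge.
Qed.

Lemma additive_approx_atom a :
  additive_approx (csem u (TAtom a)) (TAtom a).
Proof.
split=> [p q|x //]; apply/le_anti; rewrite bdiaU_le leUx.
by rewrite !le_bdia ?leUl ?leUr.
Qed.

Lemma additive_approx_mul F1 F2 t1 t2 :
  additive_approx F1 t1 -> additive_approx F2 t2 ->
  additive_approx (fun p => F2 (F1 p)) (TMul t1 t2).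
Proof.
move=> [FU1 Fle1] Fapp2; have [FU2 _] := Fapp2; split=> [p q|x].
  by rewrite FU1 FU2.
exact: le_trans (additive_approx_alpha _ Fapp2) (le_asem _ (Fle1 x)).
Qed.

Lemma additive_approxU F1 F2 t :
  additive_approx F1 t -> additive_approx F2 t ->
  additive_approx (fun p => F1 p `|` F2 p)%O t.
Proof.
move=> [FU1 Fle1] [FU2 Fle2]; split=> [p q|x]; last exact: alphaU_le.
by rewrite FU1 FU2 joinACA.
Qed.

Lemma additive_approx_weaken F t t' :
  (forall x, (asem u t x <= asem u t' x)%O) ->
  additive_approx F t -> additive_approx F t'.
Proof. by move=> tt' [FU Fle]; split=> // x; exact: le_trans (tt' x). Qed.

Lemma additive_approx_star_id t : additive_approx id (TStar t).
Proof. by split=> // x; rewrite dom_insertion; exact: (asem_star_ge t x 0). Qed.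

(** * Inductions on the derivation of a triple *)

Lemma LCK_additive_approx p t q :
  LCK u A p t q -> exists2 F, additive_approx F t & (q <= F p)%O.
Proof.
elim=> {p t q}.
- by move=> p a _; exists (csem u (TAtom a)) => //; exact: additive_approx_atom.
- move=> p p' q q' t pp _ _ [F Fapp qF] qq _; exists F => //.
  exact: le_trans qq (le_trans qF (additive_approx_le Fapp pp)).
- move=> p r q t1 t2 _ [F1 F1app rF] _ [F2 F2app qF].
  exists (fun p => F2 (F1 p)); first exact: additive_approx_mul.
  exact: le_trans qF (additive_approx_le F2app rF).
- move=> p q1 q2 t1 t2 _ [F1 F1app q1F] _ [F2 F2app q2F].
  exists (fun p => F1 p `|` F2 p)%O; last exact: leU2.
  apply: additive_approxU.
    exact: additive_approx_weaken (asem_addl t1 t2) F1app.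
  exact: additive_approx_weaken (asem_addr t1 t2) F2app.
- move=> p r q t _ [F Fapp rF] _ [G Gapp qG].
  (* The abstract semantics need not preserve joins, so p + r is split on the concrete side by
     additivity of [G]. The summand [G (F p)] approximates t followed by its star, which
     [asem_star_unfold] puts below the star. *)
  exists (fun p => G p `|` G (F p))%O.
    apply: additive_approxU => //.
    apply: (@additive_approx_weaken _ (TMul t (TStar t))).
      exact: asem_star_unfold.
    exact: additive_approx_mul.
  apply: le_trans qG _; have [GU _] := Gapp; rewrite GU.
  by apply: leU2 => //; exact: additive_approx_le Gapp _.
(* The two summands correspond to the iterates 0 and 1 of the abstract star. *)
- move=> p q t _ [F Fapp qF] _; exists (fun p => p `|` F p)%O; last exact: leU2.
  apply: additive_approxU; first exact: additive_approx_star_id.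
  by apply: additive_approx_weaken Fapp => x; exact: (asem_star_ge t x 1).
Qed.

Lemma LCK_under p t q : LCK u A p t q -> (q <= csem u t p)%O.
Proof.
elim=> {p t q}.
- by [].
- move=> p p' q q' t pp _ _ qt qq _.
  exact: le_trans qq (le_trans qt (le_bdia _ pp)).
- move=> p r q t1 t2 _ rt1 _ qt2; rewrite /csem /= bdiaM.
  exact: le_trans qt2 (le_bdia _ rt1).
- move=> p q1 q2 t1 t2 _ h1 _ h2; rewrite leUx; apply/andP; split.
    exact: le_trans h1 (bdia_lel _ (sr_leDl _ _)).
  exact: le_trans h2 (bdia_lel _ (sr_leDr _ _)).
- move=> p r q t _ rt _ qt; apply: le_trans qt _.
  apply: le_trans (bdiaU_le _ _ _) _; rewrite leUx lexx /=.
  exact: le_trans (le_bdia _ rt) (bdia_star_unfold _ _).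
- move=> p q t _ qt _; rewrite leUx; apply/andP; split.
    exact: bdia_star_ge.
  apply: le_trans qt _; apply: le_trans (bdia_star_unfold _ _).
  exact: bdia_star_ge.
Qed.

(** Starting from A(p) rather than p makes the induction compose: in seq, the bound A(r) on the
    first result is exactly the start of the second. Relax changes neither closure, by
    [alpha_between]. *)
Lemma LCK_csem_clos p t q : LCK u A p t q -> (csem u t (clos A p) <= clos A q)%O.
Proof.
elim=> {p t q}.
- by move=> p a lc; rewrite lc; exact: clos_ge.
- move=> p p' q q' t pp ppA _ IH qq qqA.
  rewrite /clos -(alpha_between pp ppA) (alpha_between qq qqA).
  exact: IH.
- move=> p r q t1 t2 _ IH1 _ IH2; rewrite /csem /= bdiaM.
  exact: le_trans (le_bdia _ IH1) IH2.
- move=> p q1 q2 t1 t2 _ IH1 _ IH2; apply: le_trans (bdiaD_le _ _ _) _.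
  rewrite leUx; apply/andP; split.
    exact: le_trans IH1 (le_clos _ (leUl _ _)).
  exact: le_trans IH2 (le_clos _ (leUr _ _)).
- move=> p r q t _ _ _; apply: le_trans.
  exact/le_bdia/le_clos/leUl.
(* A(p) is invariant under t, because S[t] A(p) <= A(q) <= A(p); hence it is invariant under the
   star. *)
- move=> p q t _ IH qA; apply: le_trans (le_clos _ (leUl _ _)).
  apply: bdia_star_inv; apply: le_trans IH _.
  exact/le_gamma/alpha_le_clos.
Qed.

Lemma LCK_asem_le p t q :
  LCK u A p t q -> (asem u t (alpha A p) <= alpha A q)%O.
Proof.
elim=> {p t q}.
- move=> p a lc /=; apply/alpha_le_clos; rewrite lc; exact: clos_ge.
- move=> p p' q q' t pp ppA _ IH qq qqA.
  by rewrite -(alpha_between pp ppA) (alpha_between qq qqA).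
- by move=> p r q t1 t2 _ IH1 _ IH2 /=; exact: le_trans (le_asem _ IH1) IH2.
- move=> p q1 q2 t1 t2 _ IH1 _ IH2; apply: asem_add_le.
    exact: le_trans IH1 (le_alpha _ (leUl _ _)).
  exact: le_trans IH2 (le_alpha _ (leUr _ _)).
- move=> p r q t _ _ _; apply: le_trans.
  exact/le_asem/le_alpha/leUl.
(* The abstract counterpart: [alpha A p] is invariant, as [alpha A q] lies below it. *)
- move=> p q t _ IH /alpha_le_clos qp.
  apply: le_trans (le_alpha _ (leUl _ _)).
  exact/asem_star_inv/(le_trans IH).
Qed.

End AbstractSemantics.

Theorem theorem2 (K : bdKAT) (hK : countably_test_complete K)
    (A : kleeneDomain K) (L : katLang) (u : evaluation L K)
    (p q : Test K) (t : term L) :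
  LCK u A p t q ->
  (q <= csem u t p)%O /\
  (asem u t (alpha A p) = alpha A q /\ alpha A q = alpha A (csem u t p)).
Proof.
move=> ptq; have qt := LCK_under ptq; split=> //; split; apply/le_anti.
  (* The converse bound passes through [F]: alpha(q) <= alpha(F p) <= S#[t] alpha(p). *)
  rewrite LCK_asem_le //=; have [F Fapp qF] := LCK_additive_approx ptq.
  exact: le_trans (le_alpha _ qF) (additive_approx_alpha _ Fapp).
(* What remains is S[t] p <= A(q), obtained by enlarging p to A(p). *)
rewrite le_alpha //=; apply/alpha_le_clos.
exact: le_trans (le_bdia _ (clos_ge A p)) (LCK_csem_clos ptq).
Qed.
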